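(* Let $\xi$ be symmetric and slowly varying, let $p,n\to\infty$ with $p/n\to\gamma\in(0,+\infty)$, and let $\widetilde{\mathbf{R}}_n=\mathbf{Z}_n\mathbf{Z}_n^\top$, where $\mathbf{Z}_n^\top$ is the $n\times p$ matrix with columns $\mathbf{z}_i=\operatorname{sign}(Y_{ik_i})\,\mathbf{e}_{k_i}\in\mathbb{R}^n$, $i=1,\dots,p$, with $k_i=\arg\max_{k=1,\dots,n}|Y_{ik}|$. Then the empirical spectral distribution $F^{\widetilde{\mathbf{R}}_n}$ converges weakly in probability to the zero-inflated Poisson distribution $H_{0,\gamma}$ given by $$H_{0,\gamma}(\{0\})=1-\gamma^{-1}+\gamma^{-1}e^{-\gamma},\qquad H_{0,\gamma}(\{k\})=\gamma^{-1}e^{-\gamma}\frac{\gamma^k}{k!},\quad k\in\{1,2,\dots\}.$$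
   Context: $\xi$ is symmetric if $\xi$ and $-\xi$ have the same law. $\xi$ is slowly varying if $\mathbb{P}(|\xi|>x)=L(x)$ for $x>0$, where $L:(0,\infty)\to(0,\infty)$ satisfies $L(tx)/L(x)\to1$ as $x\to\infty$ for every $t>0$. For i.i.d. copies $X_{ij}$ ($i,j\ge1$) of $\xi$, let $Y_{ij}=X_{ij}/\sqrt{X_{i1}^2+\cdots+X_{in}^2}$ for $1\le i\le p$, $1\le j\le n$. Ties in the $\arg\max$, if any, are broken uniformly at random, independently over $i$, so that $k_i$ is uniformly distributed on $\{1,\dots,n\}$. $\mathbf{e}_k$ is the $k$-th canonical basis vector of $\mathbb{R}^n$. For a symmetric $p\times p$ matrix $\mathbf{R}$ with eigenvalues $\lambda_1(\mathbf R),\dots,\lambda_p(\mathbf R)$, $F^{\mathbf{R}}=\frac1p\sum_{i=1}^p\delta_{\lambda_i(\mathbf{R})}$. *)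

(* Defs.v *)
From HB Require Import structures.
From mathcomp Require Import all_boot all_order all_algebra.
From mathcomp Require Import all_classical all_reals all_analysis.
From mathcomp Require Import sesquilinear spectral complex ring.

Set Implicit Arguments.
Unset Strict Implicit.
Unset Printing Implicit Defensive.

Import Order.TTheory GRing.Theory Num.Theory.
Import numFieldNormedType.Exports.

Local Open Scope classical_set_scope.
Local Open Scope ring_scope.

Section Laws.
Context (R : realType) (d : measure_display) (T : measurableType d).
Context (P : probability T R).

Definition symmetric_law (xi : {RV P >-> R}) : Prop :=
  forall B : set R, measurable B ->
    distribution P xi B = pushforward P (fun w => - xi w) B.

Definition slowly_varying (xi : {RV P >-> R}) : Prop :=
  exists L : R -> R,
    [/\ forall x, 0 < x -> 0 < L x,
        forall x, 0 < x -> P [set w | x < `|xi w|] = (L x)%:E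
      & forall t, 0 < t -> L (t * x) / L x @[x --> +oo] --> (1 : R)].

Definition mutually_independent (I : eqType) (X : I -> {RV P >-> R}) : Prop :=
  forall (s : seq I) (B : I -> set R), uniq s ->
    (forall c, measurable (B c)) ->
    P (\bigcap_(c in [set` s]) (X c @^-1` B c)) =
    (\prod_(c <- s) P (X c @^-1` B c))%E.

End Laws.

(* The variable xi may live on a probability space of its own. *)
Definition iid_copies (R : realType)
    (d0 : measure_display) (T0 : measurableType d0) (Q : probability T0 R)
    (d : measure_display) (T : measurableType d) (P : probability T R)
    (xi : {RV Q >-> R}) (X : nat -> nat -> {RV P >-> R}) : Prop :=
  (forall i j (B : set R), measurable B ->
     distribution P (X i j) B = distribution Q xi B) /\
  mutually_independent (fun c : nat * nat => X c.1 c.2).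

(* All indices start from 0: X i j, Y i j and k i stand for X_{i+1,j+1},
   Y_{i+1,j+1} and k_{i+1} - 1. *)
Section Model.
Context (R : realType) (d : measure_display) (T : measurableType d).
Context (P : probability T R) (X : nat -> nat -> {RV P >-> R}).

Definition Yentry (n i j : nat) (w : T) : R :=
  X i j w / Num.sqrt (\sum_(l < n) X i l w ^+ 2).

(* The list of all maximizers j < n of `|Y i j|. *)
Definition argmax_row (n i : nat) (w : T) : seq nat :=
  [seq j <- iota 0 n |
    all (fun l => `|Yentry n i l w| <= `|Yentry n i j w|) (iota 0 n)].

Definition data_sigma (p n : nat) : set (set T) :=
  <<s [set A | exists i j (B : set R),
         [/\ (i < p)%N, (j < n)%N, measurable B & A = X i j @^-1` B] ]>>.

(* The index k i is a maximizer, and conditionally on the data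
   (X i j)_{i < p, j < n} the indices k 0, ..., k (p - 1) are independent, each
   uniformly distributed on the set of maximizers of its row. *)
Definition random_argmax (p n : nat) (k : nat -> {RV P >-> nat}) : Prop :=
  (forall i w, (i < p)%N -> k i w \in argmax_row n i w) /\
  (forall (A : set T) (j : nat -> nat), data_sigma p n A ->
     P (A `&` [set w | forall i, (i < p)%N -> k i w = j i]) =
     (\int[P]_(w in A) (\prod_(i < p)
        ((j i \in argmax_row n i w)%:R / (size (argmax_row n i w))%:R))%:E)%E).

Definition canonical_row (n k : nat) : 'rV[R]_n :=
  \row_(j < n) (j == k :> nat)%:R.

Definition Zmatrix (p n : nat) (k : nat -> {RV P >-> nat}) (w : T)
    : 'M[R]_(p, n) :=
  \matrix_(i < p)
    (Num.sg (Yentry n i (k i w) w) *: canonical_row n (k i w)).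

Definition Rtilde (p n : nat) (k : nat -> {RV P >-> nat}) (w : T) : 'M[R]_p :=
  Zmatrix p n k w *m (Zmatrix p n k w)^T.

End Model.

Section SpectralDistribution.
Context (R : realType).

(* The eigenvalues of A listed with multiplicity (up to order); the junk value
   [::] is only taken when the characteristic polynomial does not split, which
   by eigenvaluesP does not happen for symmetric matrices. *)
Definition eigenvalues (p : nat) (A : 'M[R]_p) : seq R :=
  xget [::] [set s | char_poly A = \prod_(x <- s) ('X - x%:P)].

Lemma char_poly_similar_diag (F : fieldType) (p : nat) (A V : 'M[F]_p)
    (D : 'rV[F]_p) : V \in unitmx -> A = invmx V *m diag_mx D *m V ->
  char_poly A = \prod_(i < p) ('X - (D 0 i)%:P).
Proof.
move=> Vu ->.
have VC : map_mx polyC (invmx V) *m map_mx polyC V = 1%:M.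
  by rewrite -map_mxM mulVmx// map_mx1.
have -> : \prod_(i < p) ('X - (D 0 i)%:P) = char_poly (diag_mx D).
  rewrite char_poly_trig ?diag_mx_is_trig//.
  by apply: eq_bigr => i _; rewrite mxE eqxx mulr1n.
rewrite /char_poly; set M := char_poly_mx (diag_mx D).
have -> : char_poly_mx (invmx V *m diag_mx D *m V) =
    map_mx polyC (invmx V) *m M *m map_mx polyC V.
  rewrite /M /char_poly_mx mulmxBr mulmxBl !map_mxM; congr (_ - _).
  by rewrite mul_mx_scalar -scalemxAl VC scalemx1.
by rewrite !det_mulmx mulrAC -det_mulmx VC det1 mul1r.
Qed.

Lemma eigenvaluesP (p : nat) (A : 'M[R]_p) : A^T = A ->
  char_poly A = \prod_(x <- eigenvalues A) ('X - x%:P).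
Proof.
move=> symA; rewrite /eigenvalues; case: xgetP => [s -> //|noS].
pose f := @real_complex R.
pose Ac := map_mx f A.
have hA : Ac \is hermsymmx.
  apply/is_hermitianmxP; rewrite expr0 scale1r.
  apply/matrixP => i j; rewrite !mxE.
  by rewrite -[in LHS]symA mxE; apply/esym/CrealP; rewrite complex_real.
have /mxOverP dreal := hermitian_spectral_diag_real hA.
have /orthomx_spectralP Aeq := hermitian_normalmx hA.
have cA := char_poly_similar_diag (spectral_unit Ac) Aeq.
pose r i := complex.Re (spectral_diag Ac 0 i).
have cAR : char_poly A = \prod_(i < p) ('X - (r i)%:P).
  apply: (map_poly_inj f); rewrite map_char_poly -/Ac cA rmorph_prod/=.
  apply: eq_bigr => i _; rewrite rmorphB/= map_polyX map_polyC/=.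
  by rewrite /r /f /= RRe_real.
have := noS [seq r i | i <- enum 'I_p]; case.
by rewrite /= big_map big_enum.
Qed.

Definition esd (p : nat) (A : 'M[R]_p) : {measure set R -> \bar R} :=
  mscale (p%:R^-1)%:nng (msum (fun i => dirac (eigenvalues A)`_i) p).

End SpectralDistribution.

Section ZeroInflatedPoisson.
Context (R : realType).

Definition zero_inflated_poisson_mass (gamma : R) (k : nat) : R :=
  if k == 0%N then 1 - gamma^-1 + gamma^-1 * expR (- gamma)
  else gamma^-1 * expR (- gamma) * (gamma ^+ k / k`!%:R).

Lemma zero_inflated_poisson_mass_ge0 (gamma : {posnum R}) k :
  0 <= zero_inflated_poisson_mass gamma%:num k.
Proof.
rewrite /zero_inflated_poisson_mass; case: eqP => [_|_].
  have -> : 1 - gamma%:num^-1 + gamma%:num^-1 * expR (- gamma%:num) =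
    gamma%:num^-1 * (expR (- gamma%:num) - (1 - gamma%:num)) by field.
  by rewrite mulr_ge0// subr_ge0 expR_ge1Dx.
by rewrite !mulr_ge0// expR_ge0.
Qed.

Definition zero_inflated_poisson (gamma : {posnum R})
    : {measure set R -> \bar R} :=
  mseries (fun k =>
    mscale (NngNum (zero_inflated_poisson_mass_ge0 gamma k))
      (dirac (k%:R : R))) 0.

Lemma zero_inflated_poisson_set1 (gamma : {posnum R}) k :
  zero_inflated_poisson gamma [set k%:R] =
  (zero_inflated_poisson_mass gamma%:num k)%:E.
Proof.
rewrite /zero_inflated_poisson /= /mseries /=.
rewrite (nneseriesD1 (n := k) (P := xpredT))//= eseries0 => [|j _ /= jk].
  by rewrite adde0 /mscale/= diracE mem_set// mule1.
rewrite /mscale/= diracE memNset ?mule0//= => /eqP.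
by rewrite eqr_nat (negPf jk).
Qed.

Lemma zero_inflated_poisson_setT (gamma : {posnum R}) :
  zero_inflated_poisson gamma setT = 1%E.
Proof.
set g := gamma%:num; have g0 : 0 < g by rewrite /g gt0.
have pmf0 k : (0 <= (poisson_pmf g k)%:E)%E by rewrite lee_fin poisson_pmf_ge0.
have pmfE k : poisson_pmf g k = g ^+ k / k`!%:R * expR (- g).
  by rewrite /poisson_pmf g0.
have := @probability_setT _ _ R (poisson_prob g 0%N).
rewrite /= /poisson_prob g0 -nneseries_esumT//.
rewrite (nneseries_recl (P := xpredT))// -nneseries_addn// pmfE.
rewrite expr0 fact0 divr1 mul1r.
set S := (\sum_(i <oo) _)%E => S1.
have SE : S = (1 - expR (- g))%:E.
  by move: S1; case: S => // s [<-]; congr _%:E; ring.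
rewrite /zero_inflated_poisson /= /mseries /= (nneseries_recl (P := xpredT))//.
rewrite -nneseries_addn//.
under eq_eseriesr => i _.
  rewrite /mscale/= diracT mule1 /zero_inflated_poisson_mass addn1 /= -mulrA.
  rewrite [expR _ * _]mulrC -pmfE EFinM -addn1; over.
rewrite nneseriesZl// -/S SE /mscale/= diracT mule1.
rewrite /zero_inflated_poisson_mass/=.
by rewrite -EFinM -EFinD; congr _%:E; ring.
Qed.

End ZeroInflatedPoisson.

Section Convergence.
Context (R : realType) (d : measure_display) (T : measurableType d).
Context (P : probability T R).

Definition cvg_in_probability (U : nat -> T -> R) (u : R) : Prop :=
  forall eps : R, 0 < eps ->
    P [set w | eps < `|U n w - u|] @[n --> \oo] --> 0%E.

Definition weakly_cvg_in_probability
    (mu : nat -> T -> {measure set R -> \bar R})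
    (nu : {measure set R -> \bar R}) : Prop :=
  forall f : R -> R, continuous f -> (exists M, forall x, `|f x| <= M) ->
    cvg_in_probability (fun n w => \int[mu n w]_x f x) (\int[nu]_x f x).

End Convergence.

(* Main.v *)
Require Import Defs.
From HB Require Import structures.
From mathcomp Require Import all_boot all_order all_algebra.
From mathcomp Require Import all_classical all_reals all_analysis.
From mathcomp Require Import measurable_realfun ring lra.

Set Implicit Arguments.
Unset Strict Implicit.
Unset Printing Implicit Defensive.

Import Order.TTheory GRing.Theory Num.Theory.
Import numFieldNormedType.Exports.

Local Open Scope classical_set_scope.
Local Open Scope ring_scope.

(** Every row of [Z] is a signed basis vector (or 0), so [Z^T Z] is diagonal and
    its [j]-th entry counts the rows [i] with [k i = j].  As [Z Z^T] and [Z^T Z]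
    have the same nonzero spectrum, the integral of [f] against the empirical
    spectral distribution is [(1 - n / p) f 0] plus [1 / p] times the sum over
    [j < n] of [f] at these occupancy numbers.

    The law of the array is invariant under permutations within each row, so the
    [k i] are independent and uniform on [n] boxes.  Changing one [k i] changes
    the sum by at most [4 M] when [|f| <= M], hence an Efron-Stein bound shows
    that the statistic concentrates around its mean.  An occupancy number is
    binomial of parameters [p] and [1 / n], which converges to the Poisson law
    of parameter [gamma], and the mean converges to the integral of [f] against
    the zero-inflated Poisson distribution.  Slow variation only enters through
    [P(xi = 0) < 1], which makes rows of zeros negligible. *)

(** * Spectrum of a Gram matrix *)

(** The block matrix with rows [('X, A)] and [(B, 1)] is brought to block triangular form in two
    ways, and the resulting determinants are compared. The powers of ['X] account for the different
    sizes of the two products. *)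
Lemma char_poly_mulmxC (F : comNzRingType) (m n : nat) (A : 'M[F]_(m, n))
    (B : 'M[F]_(n, m)) :
  'X^n * char_poly (A *m B) = 'X^m * char_poly (B *m A).
Proof.
pose a := map_mx polyC A; pose b := map_mx polyC B.
pose M := block_mx ('X%:M) a b 1%:M : 'M[{poly F}]_(m + n).
have detM : \det M = char_poly (A *m B).
  have : M *m block_mx 1%:M 0 (- b) 1%:M =
      block_mx ('X%:M - a *m b) a 0 1%:M.
    rewrite mulmx_block !mulmx1 !mulmx0 !add0r mulmxN mul1mx subrr.
    by [].
  move/(congr1 determinant); rewrite det_mulmx det_lblock det_ublock !det1.
  by rewrite !mulr1 /char_poly /char_poly_mx map_mxM.
have : block_mx 1%:M 0 (- b) 'X%:M *m M =
    block_mx 'X%:M a 0 ('X%:M - b *m a).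
  rewrite mulmx_block !mul1mx !mul0mx !addr0 mulmx1 mulNmx mulNmx.
  by rewrite mul_mx_scalar mul_scalar_mx addNr [- _ + _]addrC.
move/(congr1 determinant); rewrite det_mulmx det_lblock det_ublock det1 mul1r.
rewrite !det_scalar detM => ->.
by rewrite /char_poly /char_poly_mx map_mxM.
Qed.

(** By [char_poly_mulmxC], the eigenvalues of [Z *m Z^T] padded with [n] zeros and the entries of
    [D] padded with [p] zeros form the same multiset. Padding both sides treats [p <= n] and
    [n <= p] alike. *)
Lemma sum_eigenvalues_gram (R : realType) (p n : nat) (Z : 'M[R]_(p, n))
    (D : 'rV[R]_n) (f : R -> R) : Z^T *m Z = diag_mx D ->
  \sum_(i < p) f (eigenvalues (Z *m Z^T))`_i + n%:R * f 0 =
  \sum_(j < n) f (D 0 j) + p%:R * f 0.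
Proof.
move=> ZD.
have sym : (Z *m Z^T)^T = Z *m Z^T by rewrite trmx_mul trmxK.
have := eigenvaluesP sym; set e := eigenvalues _ => eE.
have sz : size e = p.
  have := size_char_poly (Z *m Z^T).
  by rewrite eE size_prod_XsubC => -[].
have := char_poly_mulmxC Z Z^T; rewrite ZD.
rewrite (char_poly_trig (diag_mx_is_trig _)) eE => E.
have : perm_eq (nseq n 0 ++ e) (nseq p 0 ++ [seq D 0 j | j <- enum 'I_n]).
  apply: prod_XsubC_eq; rewrite !big_cat/= !big_nseq subr0 big_map big_enum/=.
  rewrite !iter_mulr_1 E; congr (_ * _); apply: eq_bigr => j _.
  by rewrite mxE eqxx mulr1n.
move=> pe; have := perm_big (op := +%R) (x := 0) (P := xpredT) (F := f) _ pe.
rewrite !big_cat/= !big_nseq big_map big_enum/= => sumE.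
move: sumE; rewrite !iter_addr_0 (big_nth 0) sz big_mkord.
rewrite -[f 0 *+ n]mulr_natl -[f 0 *+ p]mulr_natl => sumE.
by rewrite addrC sumE addrC.
Qed.

(** * Averages over allocations of p balls into n boxes *)

Section UniformAverage.
Variables (R : realType) (n : nat).
Hypothesis n0 : (0 < n)%N.

(** Expectation under the uniform law on words of length [p] over [n] letters. Recursion on the
    first letter makes conditioning on it definitional. *)
Fixpoint avg (p : nat) (F : seq nat -> R) : R :=
  if p is p'.+1 then (\sum_(j < n) avg p' (fun s => F (nat_of_ord j :: s))) / n%:R
  else F [::].

Let nR0 : n%:R != 0 :> R. Proof. by rewrite pnatr_eq0 -lt0n. Qed.
Let nR_gt0 : 0 < n%:R :> R. Proof. by rewrite ltr0n. Qed.

Lemma eq_avg p (F G : seq nat -> R) : F =1 G -> avg p F = avg p G.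
Proof. by move=> FG; congr avg; apply/funext. Qed.

Lemma avg_cst p (c : R) : avg p (fun=> c) = c.
Proof.
elim: p => //= p ->.
by rewrite sumr_const card_ord -[c *+ n]mulr_natr mulfK.
Qed.

Lemma avgD p (F G : seq nat -> R) :
  avg p (fun s => F s + G s) = avg p F + avg p G.
Proof.
elim: p F G => //= p ih F G.
by under eq_bigr do rewrite ih; rewrite big_split mulrDl.
Qed.

Lemma avgZ p (c : R) (F : seq nat -> R) :
  avg p (fun s => c * F s) = c * avg p F.
Proof.
elim: p F => //= p ih F.
by under eq_bigr do rewrite ih; rewrite -mulr_sumr mulrA.
Qed.

Lemma avgB p (F G : seq nat -> R) :
  avg p (fun s => F s - G s) = avg p F - avg p G.
Proof.
rewrite -[- avg p G]mulN1r -avgZ -avgD.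
by apply: eq_avg => s; rewrite mulN1r.
Qed.

Lemma avg_sum p m (F : 'I_m -> seq nat -> R) :
  avg p (fun s => \sum_(i < m) F i s) = \sum_(i < m) avg p (F i).
Proof.
elim: p F => //= p ih F.
by under eq_bigr do rewrite ih; rewrite exchange_big mulr_suml.
Qed.

Lemma ler_avg p (F G : seq nat -> R) :
  (forall s, F s <= G s) -> avg p F <= avg p G.
Proof.
elim: p F G => //= p ih F G FG.
rewrite ler_wpM2r ?invr_ge0//.
by apply: ler_sum => j _; apply: ih.
Qed.

(** The recursion unfolded: every word has mass [n%:R ^- p], to be matched with the point masses of
    the random indices. *)
Lemma avg_bigtuple p (F : seq nat -> R) :
  avg p F = (\sum_(t : p.-tuple 'I_n) F [seq val i | i <- t]) / n%:R ^+ p.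
Proof.
elim: p F => [|p ih] F /=.
  rewrite expr0 divr1 (big_pred1 [tuple])// => t.
  by rewrite (tuple0 t); apply/esym/eqP.
under eq_bigr do rewrite ih.
rewrite -mulr_suml -mulrA exprS invfM [_^-1 * _^-1]mulrC; congr (_ * _).
rewrite pair_bigA /=.
rewrite (reindex (fun t : p.+1.-tuple 'I_n => (thead t, [tuple of behead t]))).
  by apply: eq_bigr => t _ /=; rewrite [in RHS](tuple_eta t).
exists (fun x : 'I_n * p.-tuple 'I_n => [tuple of x.1 :: x.2]) => [t _|[j t] _] /=.
  exact/esym/tuple_eta.
by rewrite theadE; congr (_, _); apply/val_inj.
Qed.

(** The condition of McDiarmid's inequality, with the same constant for every coordinate. *)
Definition bounded_differences (F : seq nat -> R) (c : R) :=
  forall s1 s2 a b, `|F (s1 ++ a :: s2) - F (s1 ++ b :: s2)| <= c.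

(* Condition on the first coordinate: the conditional means differ by at most
   [c], so their variance is at most [c ^+ 2], and the conditional variances are
   bounded by induction. *)
Lemma avg_variance_le p (F : seq nat -> R) (c : R) :
  bounded_differences F c ->
  avg p (fun s => (F s - avg p F) ^+ 2) <= p%:R * c ^+ 2.
Proof.
elim: p F => [|p ih] F Fc; first by rewrite /= subrr expr0n mul0r.
rewrite [avg p.+1 (fun _ => _)]/=.
pose G (j : nat) := fun s => F (j :: s).
pose m j := avg p (G j); set mu := avg p.+1 F.
have muE : mu = (\sum_(j < n) m j) / n%:R by [].
have mc i j : `|m i - m j| <= c.
  rewrite -avgB ler_norml -[- c](avg_cst p) -[X in _ && (_ <= X)](avg_cst p).
  by apply/andP; split; apply: ler_avg => s;
    have := Fc [::] s i j; rewrite /= ler_norml => /andP[].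
have mmu (i : nat) : `|m i - mu| <= c.
  have -> : m i - mu = (\sum_(j < n) (m i - m j)) / n%:R.
    rewrite muE sumrB sumr_const card_ord mulrBl -[m i *+ n]mulr_natr.
    by rewrite mulfK.
  rewrite normrM normfV [`|n%:R|]ger0_norm ?ler0n// ler_pdivrMr//.
  apply: le_trans (ler_norm_sum _ _ _) _.
  apply: le_trans (_ : _ <= \sum_(j < n) c) _; first exact: ler_sum.
  by rewrite sumr_const card_ord mulr_natr.
have step (j : nat) : avg p (fun s => (G j s - mu) ^+ 2) <= p.+1%:R * c ^+ 2.
  (* Expansion around the conditional mean [m j]; the cross term averages to 0. *)
  have -> : avg p (fun s => (G j s - mu) ^+ 2) =
      avg p (fun s => (G j s - m j) ^+ 2) + (m j - mu) ^+ 2.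
    under eq_avg => s.
      have -> : (G j s - mu) ^+ 2 = (G j s - m j) ^+ 2 +
        ((2 * (m j - mu)) * (G j s - m j) + (m j - mu) ^+ 2) by ring.
      over.
    by rewrite !avgD avgZ avgB !avg_cst /m subrr mulr0 add0r.
  rewrite -natr1 mulrDl mul1r lerD//.
    by apply: ih => s1 s2 a b; exact: (Fc (j :: s1)).
  by rewrite -real_normK ?num_real// lerXn2r// nnegrE ?(le_trans _ (mmu j)).
rewrite ler_pdivrMr//.
apply: le_trans (_ : _ <= \sum_(j < n) (p.+1%:R * c ^+ 2)) _.
  by apply: ler_sum => j _; exact: step.
by rewrite sumr_const card_ord mulr_natr.
Qed.

(** The indicator of the deviation, multiplied by [eps ^+ 2], is at most the squared deviation;
    [avg_variance_le] concludes. *)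
Lemma avg_chebyshev p (F : seq nat -> R) (c eps : R) : 0 < eps ->
  bounded_differences F c ->
  avg p (fun s => (eps < `|F s - avg p F|)%R%:R) <= p%:R * c ^+ 2 / eps ^+ 2.
Proof.
move=> e0 Fc; rewrite ler_pdivlMr ?exprn_gt0// mulrC -avgZ.
apply: le_trans (avg_variance_le p Fc); apply: ler_avg => s.
case: ltP => [h|_]; last by rewrite mulr0 sqr_ge0.
rewrite mulr1 -[leRHS]real_normK ?num_real//.
by rewrite lerXn2r ?nnegrE ?(ltW e0) ?(ltW h).
Qed.

(** Mass at [k] of the binomial law of parameters [p] and [1 / n]. *)
Definition binomial_weight (p k : nat) : R :=
  'C(p, k)%:R * n%:R^-1 ^+ k * (1 - n%:R^-1) ^+ (p - k).

Lemma avg_count_mem p (j : nat) (g : nat -> R) : (j < n)%N ->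
  avg p (fun s => g (count_mem j s)) =
  \sum_(k < p.+1) binomial_weight p k * g k.
Proof.
move=> jn; elim: p g => [|p ih] g.
  by rewrite big_ord1 /binomial_weight/= bin0 !expr0 !mul1r.
(* The first ball falls into box [j] with probability [1 / n]. *)
have -> : avg p.+1 (fun s => g (count_mem j s)) =
    n%:R^-1 * avg p (fun s => g (count_mem j s).+1) +
    (1 - n%:R^-1) * avg p (fun s => g (count_mem j s)).
  rewrite /= (bigD1 (Ordinal jn))//= eqxx.
  under eq_bigr => i ij.
    have -> : (i == j :> nat) = false by apply/negbTE.
    over.
  rewrite /= sumr_const.
  have -> : #|(fun i : 'I_n => i != Ordinal jn)| = n.-1.
    by rewrite -[n in RHS]card_ord; have := cardC1 (Ordinal jn); rewrite /= => <-.
  rewrite -[_ *+ n.-1]mulr_natr -subn1 natrB//.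
  under [avg p (fun s => g (1 + _)%N)]eq_avg do rewrite add1n.
  under [X in _ + X * _]eq_avg do rewrite add0n.
  by field.
rewrite (ih (fun k => g k.+1)) ih.
(* The terms of index 0 and [p.+1] are matched separately; the others agree by Pascal's rule. *)
rewrite [RHS]big_ord_recl [in X in _ + X = _]big_ord_recl.
rewrite mulrDr addrCA; congr (_ + _).
  by rewrite /binomial_weight !bin0 !subn0 expr0 exprS; ring.
rewrite [in RHS]big_ord_recr/= [in X in X + _ = _]big_ord_recr/=.
rewrite mulrDr addrAC; congr (_ + _); last first.
  rewrite /bump/= /binomial_weight !add1n !subSS !subnn !binn exprS; ring.
rewrite !mulr_sumr -big_split/=; apply: eq_bigr => i _.
rewrite /bump/= /binomial_weight !add1n subSS binS natrD exprS.
have -> : (p - i = (p - i.+1).+1)%N by rewrite -subSn ?subSS.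
by rewrite !exprS; ring.
Qed.

End UniformAverage.

(** * Poisson limit *)

Lemma eseries_finite_support (R : realType) (a : nat -> R) N :
  (forall k, (N <= k)%N -> a k = 0) ->
  (\sum_(k <oo) (a k)%:E)%E = (\sum_(k < N) a k)%:E.
Proof.
move=> a0; apply/cvg_lim => //; apply: cvg_near_cst; exists N => // m /= Nm.
rewrite -(subnKC Nm) sumEFin; congr _%:E.
rewrite -(big_mkord xpredT a) (@big_cat_nat _ _ _ N)//= ?leq_addr//.
rewrite [X in _ + X]big_nat_cond [X in _ + X]big1 ?addr0// => i.
by rewrite andbT => /andP[/a0].
Qed.

Lemma integral_counting_finite_support (R : realType) (a : nat -> R) N :
  (forall k, (N <= k)%N -> a k = 0) ->
  (\int[counting]_k (a k)%:E)%E = (\sum_(k < N) a k)%:E.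
Proof.
move=> a0; rewrite integral_count ?(eseries_finite_support a0)//.
rewrite /summable -nneseries_esumT => [|k]; last exact: abse_ge0.
rewrite [ltLHS](_ : _ = \sum_(k <oo) (`|a k|)%:E)%E//.
rewrite (@eseries_finite_support _ (fun k => `|a k|) N) ?ltry// => k Nk.
by rewrite a0 ?normr0.
Qed.

Lemma integrable_counting (R : realType) (B : nat -> R) :
  (forall k, 0 <= B k) -> cvgn (series B) ->
  (@counting nat R).-integrable setT (EFin \o B).
Proof.
move=> B0 cB; apply/integrableP; split=> //.
rewrite (eq_integral (fun k => (B k)%:E)) => [|k _]; last first.
  by rewrite /= ger0_norm.
rewrite ge0_integral_count => [|k]; last by rewrite lee_fin.
under eq_fun do rewrite sumEFin.
by rewrite EFin_lim// ltry.
Qed.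

(** Dominated convergence for the counting measure; since [a n] vanishes from [N n] on, its integral
    is a finite sum. *)
Lemma tannery (R : realType) (a : nat -> nat -> R) (l B : nat -> R)
    (N : nat -> nat) :
  (forall n k, (N n <= k)%N -> a n k = 0) ->
  (forall k, a n k @[n --> \oo] --> l k) ->
  (\forall n \near \oo, forall k, `|a n k| <= B k) ->
  (forall k, 0 <= B k) -> cvgn (series B) ->
  \sum_(k < N n) a n k @[n --> \oo] --> fine (\int[counting]_k (l k)%:E)%E.
Proof.
(* The domination is only known from [n0] on, hence the shift. *)
move=> aN al [n0 _ aB] B0 cB; rewrite -(cvg_shiftn n0).
have [] := @dominated_convergence _ nat R counting setT measurableT
  (fun n k => (a (n + n0)%N k)%:E) (EFin \o l) (EFin \o B).
- by [].
- by [].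
- apply: aeW => k _ /=; apply: cvg_EFin; first exact: nearW.
  by rewrite (cvg_shiftn n0 (a ^~ k)).
- exact: integrable_counting.
- by apply: aeW => k n _; rewrite /= lee_fin aB//= leq_addl.
move=> il _; rewrite -[X in _ --> X -> _]fineK; last exact: integrable_fin_num.
move/fine_cvg; apply: cvg_trans; apply: near_eq_cvg; apply: nearW => n /=.
by rewrite (integral_counting_finite_support (aN _)).
Qed.

Section PoissonLimit.
Variables (R : realType) (p : nat -> nat) (g : R).
Hypothesis g0 : 0 < g.
Hypothesis poo : p n @[n --> \oo] --> \oo.
Hypothesis pg : (p n)%:R / n%:R @[n --> \oo] --> g.

Lemma cvg_natV : (n%:R^-1 : R) @[n --> \oo] --> (0 : R).
Proof. by rewrite -(cvg_shiftS (fun n => n%:R^-1 : R)); exact: cvg_harmonic. Qed.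

Let near_gt1 : \forall n \near \oo, (1 < n)%N.
Proof. exact: nbhs_infty_gt. Qed.

Lemma cvg_1BnatV : (1 - n%:R^-1 : R) @[n --> \oo] --> (1 : R).
Proof. by rewrite -[X in _ --> X]subr0; apply: cvgB; [exact: cvg_cst|exact: cvg_natV]. Qed.

Lemma natV_bounds n : (1 < n)%N -> 0 < 1 - n%:R^-1 :> R.
Proof. by move=> n1; rewrite subr_gt0 invf_lt1 ?ltr0n ?ltr1n// ltnW. Qed.

(** With [y = 1 / n], both bounds in [exp (- y / (1 - y)) <= 1 - y <= exp (- y)] come from
    [1 + t <= exp t]; they are raised to the power [p n]. *)
Lemma cvg_1BnatV_expr : (1 - n%:R^-1 : R) ^+ p n @[n --> \oo] --> expR (- g).
Proof.
apply: (@squeeze_cvgr _ _ _ _ (fun n => expR (- ((p n)%:R / n%:R / (1 - n%:R^-1))))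
   (fun n => expR (- ((p n)%:R / n%:R)))).
- near=> n; have n1 : (1 < n)%N by near: n.
  have x0 := natV_bounds n1; set x := 1 - n%:R^-1 in x0 *.
  have n0 : n%:R != 0 :> R by rewrite pnatr_eq0 -lt0n ltnW.
  apply/andP; split; rewrite /=.
    have -> : - ((p n)%:R / n%:R / x) = (p n)%:R * - (n%:R^-1 / x) by ring.
    rewrite expRM_natl lerXn2r ?nnegrE ?expR_ge0 ?(ltW x0)//.
    rewrite expRN -[leRHS]invrK lef_pV2 ?posrE ?invr_gt0 ?expR_gt0//.
    apply: le_trans (expR_ge1Dx _).
    suff <- : x^-1 = 1 + n%:R^-1 / x by [].
    by rewrite -[X in X + _](mulfV (lt0r_neq0 x0)) -mulrDl /x subrK div1r.
  rewrite -mulrN.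
  rewrite expRM_natl lerXn2r ?nnegrE ?expR_ge0 ?(ltW x0)//.
  exact: expR_ge1Dx.
- apply: (@continuous_cvg _ _ _ _ _ _ expR); first exact: continuous_expR.
  apply: cvgN; rewrite -[X in _ --> X]divr1.
  by apply: cvgM => //; apply: cvgV; [exact: oner_neq0|exact: cvg_1BnatV].
- apply: (@continuous_cvg _ _ _ _ _ _ expR); first exact: continuous_expR.
  exact: cvgN.
Unshelve. all: by end_near. Qed.

Lemma cvg_ffact k : ((p n) ^_ k)%:R / n%:R ^+ k @[n --> \oo] --> g ^+ k.
Proof.
elim: k => [|k ih].
  rewrite expr0; apply: cvg_near_cst; apply: nearW => n.
  by rewrite ffactn0 expr0 divr1.
have : (p n)%:R / n%:R - k%:R / n%:R @[n --> \oo] --> g.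
  rewrite -[X in _ --> X]subr0; apply: cvgB => //.
  by rewrite -(mulr0 (k%:R : R)); apply: cvgMr; exact: cvg_natV.
move=> /(cvgM ih); rewrite exprSr; apply: cvg_trans; apply: near_eq_cvg.
(* Once [k <= p n], the new factor [p n - k] of the falling factorial is a genuine difference. *)
near=> n; have kp : (k <= p n)%N by near: n; move/cvgnyPge : poo; apply.
rewrite /= ffactnSr natrM natrB// exprSr invfM -mulrBl; ring.
Unshelve. all: by end_near. Qed.

(** The weight is the product of [p ^_ k / n ^ k], [1 / k!] and [(1 - 1 / n) ^ p / (1 - 1 / n) ^ k],
    each of which has a limit. *)
Lemma cvg_binomial_weight k :
  binomial_weight R n (p n) k @[n --> \oo] --> expR (- g) * (g ^+ k / k`!%:R).
Proof.
have -> : expR (- g) * (g ^+ k / k`!%:R) = g ^+ k * k`!%:R^-1 * (expR (- g) / 1 ^+ k).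
  by rewrite expr1n divr1 mulrC.
have c1 : (1 - n%:R^-1 : R) ^+ k @[n --> \oo] --> (1 : R) ^+ k.
  apply: (@continuous_cvg _ _ _ _ _ _ (fun x : R => x ^+ k)).
    exact: exprn_continuous.
  exact: cvg_1BnatV.
have k1 : (1 : R) ^+ k != 0 by rewrite expr1n oner_neq0.
have : ((p n) ^_ k)%:R / n%:R ^+ k * k`!%:R^-1 *
    ((1 - n%:R^-1) ^+ p n / (1 - n%:R^-1) ^+ k) @[n --> \oo] -->
    g ^+ k * k`!%:R^-1 * (expR (- g) / 1 ^+ k).
  apply: cvgM; first by apply: cvgM; [exact: cvg_ffact|exact: cvg_cst].
  by apply: cvgM; [exact: cvg_1BnatV_expr|exact: cvgV].
apply: cvg_trans; apply: near_eq_cvg; near=> n.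
have kp : (k <= p n)%N by near: n; move/cvgnyPge : poo; apply.
have n1 : (1 < n)%N by near: n.
have /lt0r_neq0 x0 := natV_bounds n1.
rewrite /= /binomial_weight -bin_ffact natrM; set x := 1 - _ in x0 *.
have kf : k`!%:R != 0 :> R by rewrite pnatr_eq0 -lt0n fact_gt0.
have -> : x ^+ p n = x ^+ (p n - k) * x ^+ k by rewrite -exprD subnK.
have xk : x ^+ k != 0 by rewrite expf_neq0.
by rewrite exprVn mulfK// [_ / n%:R ^+ k]mulrAC mulfK.
Unshelve. all: by end_near. Qed.

(** From [q ^_ k <= q ^ k]. When [q / n] stays bounded, this gives a summable bound uniform in [n],
    as [tannery] demands. *)
Lemma binomial_weight_le n q k : (0 < n)%N ->
  0 <= binomial_weight R n q k <= (q%:R / n%:R) ^+ k / k`!%:R.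
Proof.
move=> n0.
have x0 : 0 <= 1 - n%:R^-1 :> R by rewrite subr_ge0 invf_le1 ?ltr0n// ler1n.
have x1 : 1 - n%:R^-1 <= 1 :> R by rewrite gerBl invr_ge0.
apply/andP; split; first by rewrite /binomial_weight !mulr_ge0// exprn_ge0.
rewrite /binomial_weight -[leRHS]mulr1 ler_pM// ?exprn_ge0 ?exprn_ile1//.
rewrite expr_div_n mulrAC -exprVn ler_wpM2r ?exprn_ge0//.
rewrite ler_pdivlMr ?ltr0n ?fact_gt0// -natrM bin_ffact -natrX ler_nat.
elim: k => // k ih; rewrite ffactnSr expnSr leq_mul//.
exact: leq_subr.
Qed.

Lemma cvg_zero_inflated_mean (f : nat -> R) (M : R) : (forall k, `|f k| <= M) ->
  (1 - n%:R / (p n)%:R) * f 0%N + n%:R / (p n)%:R *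
    \sum_(k < (p n).+1) binomial_weight R n (p n) k * f k @[n --> \oo] -->
  fine (\int[counting]_k (zero_inflated_poisson_mass g k * f k)%:E)%E.
Proof.
move=> fM.
have M0 : 0 <= M := le_trans (normr_ge0 _) (fM 0%N).
have gV : n%:R / (p n)%:R @[n --> \oo] --> g^-1.
  have : ((p n)%:R / n%:R)^-1 @[n --> \oo] --> g^-1.
    by apply: cvgV => //; exact: lt0r_neq0.
  apply: cvg_trans; apply: near_eq_cvg.
  by apply: nearW => n /=; rewrite invf_div.
(* The extra mass at 0 is merged into the weights, so that the whole expression is a single sum. *)
pose a n k := ((k == 0%N)%:R * (1 - n%:R / (p n)%:R) +
  n%:R / (p n)%:R * binomial_weight R n (p n) k) * f k.
(* Eventual bounds for [n / p] and [p / n]. In [B], the part [1 + c] dominates [1 - n / p] and the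
   second [c] dominates the factor [n / p] of the binomial weight. *)
pose c := g^-1 + 1; pose r := g + 1.
have c0 : 0 < c by rewrite addr_gt0// invr_gt0.
have r0 : 0 < r by rewrite addr_gt0.
pose B k := (1 + c + c) * M * exp_coeff r k.
have := @tannery R a (fun k => zero_inflated_poisson_mass g k * f k) B
  (fun n => (p n).+1).
have -> : (fun n => \sum_(k < (p n).+1) a n k) =
    (fun n => (1 - n%:R / (p n)%:R) * f 0%N + n%:R / (p n)%:R *
    \sum_(k < (p n).+1) binomial_weight R n (p n) k * f k).
  apply/funext => n; rewrite /a mulr_sumr.
  under eq_bigr do rewrite mulrDl -[_ * _ * f _ in X in _ + X]mulrA.
  rewrite big_split/=; congr (_ + _).
  by rewrite big_ord_recl big1 ?addr0 ?mul1r// => i _; rewrite !mul0r.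
apply.
- move=> n [|k] pk //; rewrite /a /binomial_weight bin_small//.
  by rewrite !(mul0r, mulr0, addr0).
- move=> k; apply: cvgM; last exact: cvg_cst.
  have -> : zero_inflated_poisson_mass g k =
      (k == 0%N)%:R * (1 - g^-1) + g^-1 * (expR (- g) * (g ^+ k / k`!%:R)).
    rewrite /zero_inflated_poisson_mass; case: eqP => [->|_] /=.
      by rewrite mul1r expr0 fact0 divr1 mulr1.
    by rewrite mul0r add0r -!mulrA.
  apply: cvgD; last by apply: cvgM => //; exact: cvg_binomial_weight.
  by apply: cvgMr; apply: cvgB => //; exact: cvg_cst.
- near=> n => k.
  have n0 : (0 < n)%N by near: n; exact: nbhs_infty_gt.
  have hc : n%:R / (p n)%:R <= c.
    near: n; apply: (cvgr_le _ gV).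
    by rewrite ltrDl.
  have hr : (p n)%:R / n%:R <= r.
    near: n; apply: (cvgr_le _ pg).
    by rewrite ltrDl.
  have h0 : 0 <= n%:R / (p n)%:R :> R by rewrite divr_ge0.
  have /andP[w0 w1] := binomial_weight_le (p n) k n0.
  have wE : binomial_weight R n (p n) k <= exp_coeff r k.
    apply: le_trans w1 _; rewrite /exp_coeff/= ler_wpM2r ?invr_ge0//.
    by rewrite lerXn2r ?nnegrE ?divr_ge0// ltW.
  have E0 : 0 <= exp_coeff r k by rewrite exp_coeff_ge0// ltW.
  (* The coefficient of index 0 equals 1, so the atom at 0 has the same majorant. *)
  have dE : (k == 0%N)%:R <= exp_coeff r k.
    by case: eqP => [->|//]; rewrite /exp_coeff/= expr0 fact0 divr1.
  rewrite /a /B normrM [leRHS]mulrAC ler_pM//.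
  apply: le_trans (ler_normD _ _) _.
  rewrite mulrDl lerD// normrM.
    rewrite mulrC ler_pM// ?normr_nat//.
    by rewrite (le_trans (ler_normB _ _))// normr1 lerD// ger0_norm.
  by rewrite !ger0_norm// ler_pM.
- move=> k; rewrite /B mulr_ge0 ?exp_coeff_ge0 ?(ltW r0)//.
  by apply: mulr_ge0 => //; do 2![apply: addr_ge0; last exact: ltW].
- have -> : B = (fun k => ((1 + c + c) * M) *: (exp_coeff r k : R^o)) by [].
  by apply: is_cvg_seriesZ; exact: is_cvg_series_exp_coeff.
Unshelve. all: by end_near. Qed.

End PoissonLimit.

(** * Uniformity of the indices *)

Section JointLaw.
Context (R : realType).

(** A pi-system generating the product sigma-algebra on arrays; laws of arrays are compared on
    it. *)
Definition cylinders : set (set (nat * nat -> R)) :=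
  [set A | exists (s : seq (nat * nat)) (B : nat * nat -> set R),
    [/\ uniq s, forall c, measurable (B c) &
        A = \bigcap_(c in [set` s]) [set x | B c (x c)] ]].

Lemma cylindersI : setI_closed cylinders.
Proof.
move=> _ _ [s1 [B1 [_ mB1 ->]]] [s2 [B2 [_ mB2 ->]]].
exists (undup (s1 ++ s2)).
(* A coordinate constrained by only one of the two cylinders gets [setT] from the other. *)
exists (fun c => (if c \in s1 then B1 c else setT) `&`
                 (if c \in s2 then B2 c else setT)); split.
- exact: undup_uniq.
- by move=> c; apply: measurableI; case: ifP.
apply/seteqP; split=> x.
  move=> [x1 x2] c; rewrite /= mem_undup mem_cat => _; split.
    by case: ifP => // /x1.
  by case: ifP => // /x2.
move=> h; split=> c /= cs.
  by have := h c; rewrite /= mem_undup mem_cat cs => /(_ isT)[].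
by have := h c; rewrite /= mem_undup mem_cat cs orbT => /(_ isT)[].
Qed.

Lemma cylindersT : cylinders setT.
Proof.
exists [::], (fun=> setT); split=> //.
by apply/seteqP; split=> x.
Qed.

Local Notation arrays := (g_sigma_algebraType cylinders).

Lemma measurable_coordinate c :
  measurable_fun setT (fun x : arrays => x c : R).
Proof.
move=> _ B mB; rewrite setTI; apply: sub_sigma_algebra.
exists [:: c], (fun=> B); split=> //.
apply/seteqP; split=> x /=; first by move=> Bx c'; rewrite /= inE => /eqP ->.
by apply; rewrite /= inE.
Qed.

Context (d : measure_display) (T : measurableType d) (P : probability T R).
Context (X : nat -> nat -> {RV P >-> R}).

Definition permuted_array (s : nat * nat -> nat * nat) (w : T) : arrays :=
  fun c => X (s c).1 (s c).2 w.

Lemma preimage_cylinder (s : nat * nat -> nat * nat) (l : seq (nat * nat))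
    (B : nat * nat -> set R) :
  permuted_array s @^-1` (\bigcap_(c in [set` l]) [set x | B c (x c)]) =
  \bigcap_(c in [set` l]) (X (s c).1 (s c).2 @^-1` B c).
Proof. by []. Qed.

Lemma measurable_permuted_array s : measurable_fun setT (permuted_array s).
Proof.
apply: (@measurability _ _ T arrays setT _ cylinders) => // _ [_ [l [B [_ mB ->]]] <-].
rewrite setTI preimage_cylinder; apply: fin_bigcap_measurable => // c _.
exact: measurable_funPTI.
Qed.

HB.instance Definition _ s :=
  isMeasurableFun.Build _ _ _ _ (permuted_array s) (measurable_permuted_array s).

Context (d0 : measure_display) (T0 : measurableType d0) (Q : probability T0 R)
  (xi : {RV Q >-> R}).
Hypothesis iidX : iid_copies xi X.

Lemma iid_measure_preimage i j (B : set R) : measurable B ->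
  P (X i j @^-1` B) = Q (xi @^-1` B).
Proof. by case: iidX => /(_ i j B) + _ mB => /(_ mB). Qed.

Lemma iid_measure_bigcap (l : seq (nat * nat)) (B : nat * nat -> set R) :
  uniq l -> (forall c, measurable (B c)) ->
  P (\bigcap_(c in [set` l]) (X c.1 c.2 @^-1` B c)) =
  (\prod_(c <- l) Q (xi @^-1` B c))%E.
Proof.
move=> ul mB; case: iidX => _ /(_ l B ul mB) ->.
by apply: eq_bigr => c _; rewrite iid_measure_preimage.
Qed.

(** Reindexing by [s] turns this event into a cylinder event for the original array, and the factors
    of its probability do not depend on the positions. *)
Lemma permuted_array_cylinder s (l : seq (nat * nat)) (B : nat * nat -> set R) :
  involutive s -> uniq l -> (forall c, measurable (B c)) ->
  P (\bigcap_(c in [set` l]) (X (s c).1 (s c).2 @^-1` B c)) =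
  (\prod_(c <- l) Q (xi @^-1` B c))%E.
Proof.
move=> sK ul mB.
have := @iid_measure_bigcap [seq s c | c <- l] (fun c => B (s c)).
rewrite map_inj_uniq ?big_map; last exact: inv_inj.
under eq_bigr do rewrite sK.
move=> /(_ ul (fun c => mB _)) <-; congr (P _).
apply/seteqP; split=> w /= h c.
  by move=> /mapP[c' c'l ->] /=; rewrite sK; exact: h.
by move=> cl; have := h (s c) (map_f s cl); rewrite /= sK.
Qed.

(** The two laws agree on the pi-system [cylinders], hence on the sigma-algebra it generates. *)
Lemma eq_permuted_array_law s (A : set arrays) : involutive s -> measurable A ->
  distribution P (permuted_array s) A = distribution P (permuted_array id) A.
Proof.
move=> sK mA.
apply: (@measure_unique _ R arrays cylinders (fun=> setT) erefl _ _ _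
  (distribution P (permuted_array s)) (distribution P (permuted_array id))) => //.
- exact: cylindersI.
- by move=> _; exact: cylindersT.
- by apply/seteqP; split=> // x _; exists 0%N.
- move=> _ [l [B [ul mB ->]]].
  transitivity (\prod_(c <- l) Q (xi @^-1` B c))%E.
    exact: permuted_array_cylinder.
  by apply/esym; exact: (@permuted_array_cylinder id).
- by move=> _; apply: fin_num_fun_lty; exact: fin_num_measure.
Qed.

Lemma ge0_integral_permuted_array s (f : arrays -> R) : involutive s ->
  measurable_fun setT f -> (forall x, 0 <= f x) ->
  (\int[P]_w (f (permuted_array s w))%:E =
   \int[P]_w (f (permuted_array id w))%:E)%E.
Proof.
move=> sK mf f0.
have mEf : measurable_fun setT (EFin \o f) by exact/measurable_EFinP.
have E t : (\int[P]_w (f (permuted_array t w))%:E =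
    \int[distribution P (permuted_array t)]_x (f x)%:E)%E.
  rewrite /distribution ge0_integral_pushforward// ?preimage_setT//.
  by move=> x _; rewrite lee_fin.
rewrite !E; apply: eq_measure_integral => A mA _.
exact: eq_permuted_array_law.
Qed.

End JointLaw.

(** * Maximizers of a row and their behaviour under transpositions *)

Section Maximizers.
Context (R : realType).
Implicit Types (n : nat) (x : nat -> R).

(** Counterpart of [argmax_row] for a deterministic row without normalization; the two are
    identified in [argmax_rowE]. *)
Definition maximizers n x : seq nat :=
  [seq j <- iota 0 n | all (fun l => `|x l| <= `|x j|) (iota 0 n)].

Lemma maximizersP n x j :
  reflect ((j < n)%N /\ forall l, (l < n)%N -> `|x l| <= `|x j|)
    (j \in maximizers n x).
Proof.
rewrite mem_filter mem_iota add0n /=; apply: (iffP andP) => [[/allP h jn]|[jn h]].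
  by split=> // l ln; apply: h; rewrite mem_iota.
by split=> //; apply/allP => l; rewrite mem_iota => /h.
Qed.

Lemma size_maximizers_gt0 n x : (0 < n)%N -> (0 < size (maximizers n x))%N.
Proof.
case: n => // n _.
have [j _ h] := @arg_maxP _ R 'I_n.+1 ord0 xpredT (fun i => `|x i|) isT.
suff : (j : nat) \in maximizers n.+1 x by case: maximizers.
by apply/maximizersP; split=> // l ln; exact: (h (Ordinal ln)).
Qed.

Definition transpose (a b l : nat) : nat :=
  if l == a then b else if l == b then a else l.

Lemma transposeK a b : involutive (transpose a b).
Proof.
move=> l; rewrite /transpose; case: (eqVneq l a) => [->|la].
  by rewrite eqxx; case: eqP.
by case: (eqVneq l b) => [->|lb]; rewrite ?eqxx// (negbTE la) (negbTE lb).
Qed.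

Lemma transposeL a b : transpose a b a = b.
Proof. by rewrite /transpose eqxx. Qed.

Lemma transpose_lt n a b l : (a < n)%N -> (b < n)%N -> (l < n)%N ->
  (transpose a b l < n)%N.
Proof. by rewrite /transpose; case: ifP => // _; case: ifP. Qed.

Lemma mem_maximizers_transpose n x a b j : (a < n)%N -> (b < n)%N ->
  (j \in maximizers n (x \o transpose a b)) =
  (transpose a b j \in maximizers n x).
Proof.
move=> an bn; have tn := transpose_lt an bn.
apply/maximizersP/maximizersP => -[jn h]; split.
- exact: tn.
- by move=> l ln; have := h _ (tn _ ln); rewrite /= transposeK.
- by rewrite -(transposeK a b j) tn.
- by move=> l ln; exact: (h _ (tn _ ln)).
Qed.

Lemma size_maximizers_transpose n x a b : (a < n)%N -> (b < n)%N ->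
  size (maximizers n (x \o transpose a b)) = size (maximizers n x).
Proof.
move=> an bn; rewrite -(size_map (transpose a b)); apply: perm_size.
apply: uniq_perm.
- by rewrite map_inj_uniq ?filter_uniq ?iota_uniq//; exact: inv_inj (@transposeK a b).
- by rewrite filter_uniq ?iota_uniq.
move=> j; rewrite -[in LHS](transposeK a b j) mem_map; last first.
  exact: inv_inj (@transposeK a b).
by rewrite mem_maximizers_transpose// transposeK.
Qed.

(** Conditional probability, given the row [x], that uniform tie-breaking selects [j]. *)
Definition argmax_weight n x j : R :=
  (j \in maximizers n x)%:R / (size (maximizers n x))%:R.

Lemma argmax_weight_ge0 n x j : 0 <= argmax_weight n x j.
Proof. by rewrite divr_ge0. Qed.

Lemma argmax_weight_transpose n x a b : (a < n)%N -> (b < n)%N ->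
  argmax_weight n (x \o transpose a b) a = argmax_weight n x b.
Proof.
move=> an bn; rewrite /argmax_weight mem_maximizers_transpose// transposeL.
by rewrite size_maximizers_transpose.
Qed.

Lemma sum_argmax_weight n x : (0 < n)%N ->
  \sum_(j < n) argmax_weight n x j = 1.
Proof.
move=> n0; rewrite -mulr_suml.
have -> : \sum_(j < n) (nat_of_ord j \in maximizers n x)%:R =
    (size (maximizers n x))%:R :> R.
  under eq_bigr do rewrite mem_filter mem_iota ltn_ord andbT.
  rewrite size_filter; set b := (X in count X); rewrite -sum1_count natr_sum.
  have iotaE : iota 0 n = index_iota 0 n by rewrite /index_iota subn0.
  by rewrite [in RHS]iotaE [RHS]big_mkcond big_mkord; apply: eq_bigr => j _; rewrite /b; case: ifP.
by rewrite mulfV// pnatr_eq0 -lt0n size_maximizers_gt0.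
Qed.

End Maximizers.

(** * Measurability of the selection weights *)

Section MeasurableWeight.
Context (R : realType) (d : measure_display) (T : measurableType d).

Lemma measurable_all (l : seq nat) (b : nat -> T -> bool) :
  (forall i, measurable_fun setT (b i)) ->
  measurable_fun setT (fun w => all (b ^~ w) l).
Proof.
move=> mb; elim: l => [|i l ih] /=; first exact: measurable_cst.
exact: measurable_and.
Qed.

Lemma measurable_size_filter (l : seq nat) (b : nat -> T -> bool) :
  (forall i, measurable_fun setT (b i)) ->
  measurable_fun setT (fun w => size [seq i <- l | b i w]).
Proof.
move=> mb; elim: l => [|i l ih] /=; first exact: measurable_cst.
have -> : (fun w => size (if b i w then i :: [seq j <- l | b j w]
    else [seq j <- l | b j w])) =
  (fun w => if b i w then (size [seq j <- l | b j w]).+1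
    else size [seq j <- l | b j w]).
  by apply/funext => w; case: ifP.
by apply: measurable_fun_ifT => //; exact: (measurableT_comp (f := succn)).
Qed.

Lemma measurable_argmax_weight n (x : nat -> T -> R) j :
  (forall l, measurable_fun setT (x l)) ->
  measurable_fun setT (fun w => argmax_weight n (x ^~ w) j).
Proof.
move=> mx.
have mle i l : measurable_fun setT (fun w => `|x i w| <= `|x l w|).
  by apply: measurable_fun_ler; exact: measurableT_comp.
have mall i : measurable_fun setT
    (fun w => all (fun l => `|x l w| <= `|x i w|) (iota 0 n)).
  exact: (@measurable_all _ (fun l w => `|x l w| <= `|x i w|)).
apply: measurable_funM.
  apply: (@measurableT_comp _ _ _ T bool R (fun b : bool => b%:R)) => //.
  rewrite [X in measurable_fun _ X](_ : _ = (fun w => (j < n)%N &&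
      all (fun l => `|x l w| <= `|x j w|) (iota 0 n))); last first.
    by apply/funext => w; rewrite mem_filter mem_iota andbC.
  by apply: measurable_and.
apply: (@measurableT_comp _ _ _ T nat R (fun m : nat => m%:R^-1)) => //.
exact: measurable_size_filter.
Qed.

End MeasurableWeight.

(** * Joint uniform law of the selected indices *)

Section UniformArgmax.
Context (R : realType).
Context (d0 : measure_display) (T0 : measurableType d0) (Q : probability T0 R)
  (xi : {RV Q >-> R}).
Context (d : measure_display) (T : measurableType d) (P : probability T R)
  (X : nat -> nat -> {RV P >-> R}).
Hypothesis iidX : iid_copies xi X.
Variables (p n : nat).
Hypothesis n0 : (0 < n)%N.

(** Dividing by a positive norm preserves the comparisons. If the norm is 0, the row vanishes and
    every index is a maximizer on both sides. *)
Lemma argmax_rowE i w : argmax_row X n i w = maximizers n (fun l => X i l w).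
Proof.
rewrite /argmax_row /maximizers; apply: eq_in_filter => j.
rewrite mem_iota /= => jn; apply: eq_in_all => l; rewrite mem_iota /= => ln.
rewrite /Yentry !normrM !normfV; set S := Num.sqrt _.
have [S0|S0] := eqVneq S 0; last by rewrite ler_pM2r ?invr_gt0 ?normr_gt0.
have Xz m : (m < n)%N -> X i m w = 0.
  move=> mn; move/eqP : S0; rewrite sqrtr_eq0 => S0; apply/eqP.
  have : \sum_(l < n) X i l w ^+ 2 == 0.
    by rewrite eq_le S0 sumr_ge0// => k _; exact: sqr_ge0.
  rewrite psumr_eq0 => [|k _]; last exact: sqr_ge0.
  by move/allP/(_ (Ordinal mn) (mem_index_enum _)); rewrite /= sqrf_eq0.
by rewrite !Xz// S0 normr0 !mul0r.
Qed.

Let weight (j : nat -> nat) (x : nat * nat -> R) : R :=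
  \prod_(i < p) argmax_weight n (fun l => x (nat_of_ord i, l)) (j i).

Let measurable_weight j :
  measurable_fun setT (weight j : g_sigma_algebraType (@cylinders R) -> R).
Proof.
apply: measurable_prod => i _; apply: measurable_argmax_weight => l.
exact: measurable_coordinate.
Qed.

Let weight_ge0 j x : 0 <= weight j x.
Proof. by apply: prodr_ge0 => i _; exact: argmax_weight_ge0. Qed.

Let integral_weight_eq (j j' : nat -> nat) :
  (forall i, (i < p)%N -> (j i < n)%N) -> (forall i, (i < p)%N -> (j' i < n)%N) ->
  (\int[P]_w (weight j (permuted_array X id w))%:E =
   \int[P]_w (weight j' (permuted_array X id w))%:E)%E.
Proof.
move=> jn j'n.
(* In each row [i], the positions [j i] and [j' i] are exchanged; this keeps the law of the array
   and carries one weight to the other. *)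
pose s (c : nat * nat) := (c.1, transpose (j c.1) (j' c.1) c.2).
have sK : involutive s by move=> [a b]; rewrite /s /= transposeK.
rewrite -(ge0_integral_permuted_array iidX sK)//.
apply: eq_integral => w _; congr _%:E; apply: eq_bigr => i _.
by rewrite -[RHS](argmax_weight_transpose _ (jn _ (ltn_ord i)) (j'n _ (ltn_ord i))).
Qed.

(* All [n ^ p] choices of [j] give the same integral, and by [sum_argmax_weight]
   these integrals add up to 1. *)
Lemma integral_argmax_weight (j : nat -> nat) :
  (forall i, (i < p)%N -> (j i < n)%N) ->
  (\int[P]_w (weight j (permuted_array X id w))%:E = (n%:R ^- p)%:E)%E.
Proof.
move=> jn.
(* Extension of [f] to all naturals; the default 0 is never read, as weights only involve
   [i < p]. *)
pose jf (f : {ffun 'I_p -> 'I_n}) (i : nat) : nat :=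
  oapp (fun i => nat_of_ord (f i)) 0%N (insub i).
have sumW x : \sum_(f : {ffun 'I_p -> 'I_n}) weight (jf f) x = 1.
  (* Distributivity turns the sum over all allocations into a product of row sums, each equal to
     1. *)
  transitivity (\prod_(i < p) \sum_(l < n)
      argmax_weight n (fun l => x (nat_of_ord i, l)) l).
    rewrite bigA_distr_bigA; apply: eq_bigr => f _; apply: eq_bigr => i _.
    by rewrite /jf valK.
  by rewrite big1// => i _; exact: sum_argmax_weight.
have : (\sum_(f : {ffun 'I_p -> 'I_n})
    \int[P]_w (weight (jf f) (permuted_array X id w))%:E = 1)%E.
  rewrite -ge0_integral_sum//; last 2 first.
  - move=> f; apply/measurable_EFinP.
    by apply: measurableT_comp => //; exact: measurable_permuted_array.
  - by move=> f w _; rewrite lee_fin.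
  under eq_integral do rewrite sumEFin sumW.
  rewrite integral_cst// mul1e; exact: probability_setT.
rewrite (eq_bigr (fun=> \int[P]_w (weight j (permuted_array X id w))%:E)%E); last first.
  move=> f _; apply: integral_weight_eq => // i ip.
  by rewrite /jf (insubT (fun m => (m < p)%N) ip) /= ltn_ord.
set I := (\int[P]_w _)%E.
have I0 : (0 <= I)%E by apply: integral_ge0 => w _; rewrite lee_fin.
have np0 : (n ^ p)%:R != 0 :> R by rewrite pnatr_eq0 -lt0n expn_gt0 n0.
rewrite sumr_const card_ffun !card_ord.
have -> : (I *+ (n ^ p))%R = ((n ^ p)%:R%:E * I)%E by rewrite mule_natl.
case: I I0 => [r||] //=.
  move=> _ []; rewrite -natrX => /(canRL (mulKf np0)) ->.
  by rewrite mulr1.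
(* An infinite integral is excluded: its positive multiple would be infinite, not 1. *)
by move=> _; rewrite gt0_muley// lte_fin lt0r np0 ler0n.
Qed.

Variable k : nat -> {RV P >-> nat}.
Hypothesis kP : random_argmax X p n k.

(** The conditional law in [random_argmax] is integrated over the whole space. *)
Lemma random_argmax_uniform (j : nat -> nat) :
  (forall i, (i < p)%N -> (j i < n)%N) ->
  P [set w | forall i, (i < p)%N -> k i w = j i] = (n%:R ^- p)%:E.
Proof.
move=> jn; case: kP => _ /(_ setT j).
rewrite setTI => ->.
  rewrite -(integral_argmax_weight jn); apply: eq_integral => w _.
  by congr _%:E; apply: eq_bigr => i _; rewrite argmax_rowE.
by move=> B [[B0 BC _] _]; rewrite -setC0 -setTD; exact: BC.
Qed.

Lemma random_argmax_lt i w : (i < p)%N -> (k i w < n)%N.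
Proof.
case: kP => /(_ i w) + _ ip => /(_ ip).
by rewrite argmax_rowE => /maximizersP[].
Qed.

(** The event is a finite disjoint union of the atoms [F t], each of probability [n%:R ^- p]. *)
Lemma probability_argmax_avg (E : pred (seq nat)) :
  P [set w | E [seq k i w | i <- iota 0 p]] =
  (avg n p (fun s => (E s)%:R))%:E.
Proof.
pose F (t : p.-tuple 'I_n) :=
  [set w | forall i, (i < p)%N -> k i w = nth 0%N [seq val l | l <- t] i].
have Ft t : F t = [set w | [seq k i w | i <- iota 0 p] = [seq val l | l <- t]].
  have st : size [seq val l | l <- t] = p by rewrite size_map size_tuple.
  apply/seteqP; split=> w /= h.
    apply: (@eq_from_nth _ 0%N); rewrite size_map size_iota ?st// => i ip.
    by rewrite (nth_map 0%N) ?size_iota// nth_iota// add0n h.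
  by move=> i ip; rewrite -h (nth_map 0%N) ?size_iota// nth_iota.
have mF t : measurable (F t).
  have -> : F t = \bigcap_(i in [set i | (i < p)%N])
      (k i @^-1` [set nth 0%N [seq val l | l <- t] i]).
    by apply/seteqP; split.
  apply: bigcap_measurableType => i _; exact: measurable_funPTI.
have -> : [set w | E [seq k i w | i <- iota 0 p]] =
    \bigcup_(t in [set t : p.-tuple 'I_n | E [seq val l | l <- t]]) F t.
  apply/seteqP; split=> w /=.
    move=> Ew.
    (* For [i < p] the default is not taken, by [random_argmax_lt]. *)
    pose f i : 'I_n := insubd (Ordinal n0) (k i w).
    have sf : size [seq f i | i <- iota 0 p] == p by rewrite size_map size_iota.
    have vf : [seq val l | l <- [seq f i | i <- iota 0 p]] = [seq k i w | i <- iota 0 p].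
      rewrite -map_comp; apply/eq_in_map => i; rewrite mem_iota => /andP[_ ip].
      by rewrite /= /f val_insubd random_argmax_lt.
    by exists (Tuple sf); rewrite ?Ft/= vf.
  by move=> [t Et]; rewrite Ft => /= ->.
rewrite measure_fin_bigcup//; last 2 first.
- exact: finite_finset.
- move=> t1 t2 _ _ [w []]; rewrite !Ft /= => -> h; apply/val_inj => /=.
  exact: inj_map val_inj _ _ h.
rewrite avg_bigtuple// -(@bigfs _ _ _ _ (index_enum _)) ?index_enum_uniq//; last first.
  by move=> t _; rewrite mem_index_enum.
rewrite (eq_bigr (fun=> (n%:R ^- p)%:E)) => [|t _]; last first.
  apply: random_argmax_uniform => i ip.
  by rewrite (nth_map (Ordinal n0)) ?size_tuple//; exact: ltn_ord.
rewrite sumEFin mulr_suml [in LHS]big_mkcond; congr _%:E; apply: eq_bigr => t _.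
by case: ifP; rewrite ?mul1r ?mul0r.
Qed.

End UniformArgmax.

(** * Rows of zeros *)

(** Used with [q] the mass of [xi] at 0, to make the bound [p q^n] on the probability of a zero row
    vanish. *)
Lemma cvg_natmul_expr (R : realType) (q : R) : 0 <= q -> q < 1 ->
  n%:R * q ^+ n @[n --> \oo] --> (0 : R).
Proof.
move=> q0 q1; pose r := Num.sqrt q.
have r0 : 0 <= r by exact: sqrtr_ge0.
have r1 : r < 1 by rewrite -sqrtr1 ltr_sqrt.
have rE : q = r * r by rewrite -expr2 sqr_sqrtr.
have r10 : 0 < 1 - r by rewrite subr_gt0.
(* [n r^n <= 1 + r + ... + r^(n-1)], and [q^n = r^n r^n] *)
have bound n : n%:R * r ^+ n <= (1 - r)^-1.
  rewrite -[leRHS]mul1r ler_pdivlMr// mulrC.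
  have : 1 - r ^+ n <= 1 by rewrite gerBl exprn_ge0.
  apply: le_trans.
  rewrite -[leRHS]opprB subrX1 -mulNr opprB ler_wpM2l ?(ltW r10)//.
  rewrite mulr_natl -[n in _ *+ n]card_ord -sumr_const; apply: ler_sum => i _.
  by rewrite ler_wiXn2l ?(ltW r1)// ltnW.
apply: (@squeeze_cvgr _ _ _ _ (fun=> 0) (fun n => (1 - r)^-1 * r ^+ n)).
- apply: nearW => n; rewrite mulr_ge0 ?exprn_ge0//= rE exprMn mulrA.
  by rewrite ler_wpM2r ?exprn_ge0.
- exact: cvg_cst.
- rewrite -[X in _ --> X](mulr0 (1 - r)^-1); apply: cvgMr.
  by apply: cvg_expr; rewrite ger0_norm.
Qed.

Section ZeroRows.
Context (R : realType).
Context (d0 : measure_display) (T0 : measurableType d0) (Q : probability T0 R)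
  (xi : {RV Q >-> R}).
Context (d : measure_display) (T : measurableType d) (P : probability T R)
  (X : nat -> nat -> {RV P >-> R}).

Definition zero_row (n i : nat) : set T :=
  [set w | forall l, (l < n)%N -> X i l w = 0].

(** The exceptional event: outside it, a maximal entry of each row is nonzero and has sign 1 or
    -1. *)
Definition some_zero_row (p n : nat) : set T :=
  \big[setU/set0]_(i < p) zero_row n i.

Lemma zero_rowE n i :
  zero_row n i = \bigcap_(c in [set` [seq (i, l) | l <- iota 0 n]])
    (X c.1 c.2 @^-1` [set 0]).
Proof.
apply/seteqP; split=> w /= h.
  by move=> _ /mapP[l + ->]; rewrite mem_iota => /h.
move=> l ln; apply: (h (i, l)); rewrite /= mem_map ?mem_iota// => a b.
by case.
Qed.

Lemma measurable_zero_row n i : measurable (zero_row n i).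
Proof.
by rewrite zero_rowE; apply: fin_bigcap_measurable.
Qed.

Lemma measurable_some_zero_row p n : measurable (some_zero_row p n).
Proof. by apply: bigsetU_measurable => i _; exact: measurable_zero_row. Qed.

Hypothesis iidX : iid_copies xi X.

(** Union bound over the rows, and independence within each row. *)
Lemma probability_some_zero_row_le p n :
  (P (some_zero_row p n) <= (p%:R * fine (Q (xi @^-1` [set 0])) ^+ n)%:E)%E.
Proof.
apply: le_trans (Boole_inequality _ _) _ => [i _|]; first exact: measurable_zero_row.
rewrite (eq_bigr (fun=> (fine (Q (xi @^-1` [set 0])) ^+ n)%:E)) => [|i _].
  by rewrite sumEFin sumr_const card_ord mulr_natl.
have ul : uniq [seq (nat_of_ord i, l) | l <- iota 0 n].
  by rewrite map_inj_uniq ?iota_uniq// => a b [].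
rewrite zero_rowE.
transitivity (\prod_(c <- [seq (nat_of_ord i, l) | l <- iota 0 n])
    Q (xi @^-1` [set 0%R]))%E.
  exact: (iid_measure_bigcap iidX (B := fun=> [set 0]) ul).
rewrite big_map -{1}[Q _]fineK; last by apply: fin_num_measure; exact: measurable_funPTI.
by rewrite prodEFin big_const_seq count_predT size_iota iter_mulr_1.
Qed.

(** The event [1 < |xi|] has probability [L 1 > 0] and is disjoint from [xi = 0]. *)
Lemma slowly_varying_atom0_lt1 : slowly_varying xi ->
  fine (Q (xi @^-1` [set 0])) < 1.
Proof.
move=> [L [L0 LE _]].
have mA : measurable (xi @^-1` [set 0]) by exact: measurable_funPTI.
have mB : measurable [set w | 1 < `|xi w|].
  have mlt : measurable_fun setT (fun w => 1 < `|xi w|).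
    by apply: measurable_fun_ltr => //; exact: measurableT_comp.
  by rewrite -[X in measurable X]setTI; exact: (mlt measurableT [set true]).
pose A := xi @^-1` [set 0]; pose B := [set w | 1 < `|xi w|].
have QAB : Q (A `|` B) = (Q A + Q B)%E.
  rewrite measureU//; apply/seteqP; split=> // w [xi0] /=.
  by rewrite /B/= (_ : xi w = 0)// normr0 ltr10.
have : (Q (A `|` B) <= 1)%E by exact: probability_le1 (measurableU _ _ mA mB).
rewrite QAB /B LE// -[Q A]fineK; last exact: fin_num_measure.
by rewrite -EFinD lee_fin -/A; have := L0 1 ltr01; lra.
Qed.

End ZeroRows.

(** * Integrals against the empirical spectral distribution *)

Lemma Rintegral_esd (R : realType) (p : nat) (A : 'M[R]_p) (f : R -> R) :
  measurable_fun setT f ->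
  \int[esd A]_x f x = p%:R^-1 * \sum_(i < p) f (eigenvalues A)`_i.
Proof.
move=> mf; have mEf : measurable_fun setT (fun x : R => (f x)%:E) by exact/measurable_EFinP.
(* The formula is first proved for nonnegative functions, then applied to the positive and negative
   parts of [f]. *)
have ge0E (h : R -> \bar R) : measurable_fun (@setT R) h -> (forall x, (0 <= h x)%E) ->
    (\int[esd A]_x h x = p%:R^-1%:E * \sum_(i < p) h (eigenvalues A)`_i)%E.
  move=> mh h0; rewrite /esd ge0_integral_mscale// ge0_integral_measure_sum//.
  congr (_ * _)%E; apply: eq_bigr => i _.
  by rewrite integral_dirac// diracT mul1e.
rewrite /Rintegral integralE !ge0E//; last 2 first.
- exact: measurable_funeneg.
- exact: measurable_funepos.
have posE (x : R) : ((fun x => (f x)%:E)^\+ x = (Num.max (f x) 0)%:E)%E by rewrite funeposE EFin_max.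
have negE (x : R) : ((fun x => (f x)%:E)^\- x = (Num.max (- f x) 0)%:E)%E.
  by rewrite funenegE -EFinN EFin_max.
under eq_bigr do rewrite posE.
under [X in (_ - _ * X)%E]eq_bigr do rewrite negE.
rewrite !sumEFin -!EFinM -EFinB /= -mulrBr -sumrB; congr (_ * _).
by apply: eq_bigr => i _; rewrite !maxEle oppr_le0; case: ltgtP => // *; lra.
Qed.

(** Puts the target integral in the form of the limit in [cvg_zero_inflated_mean]; the proof again
    splits [f] into its positive and negative parts. *)
Lemma Rintegral_zero_inflated_poisson (R : realType) (gamma : {posnum R})
    (f : R -> R) : measurable_fun setT f ->
  \int[zero_inflated_poisson gamma]_x f x = fine (\int[counting]_k
    (zero_inflated_poisson_mass gamma%:num k * f k%:R)%:E)%E.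
Proof.
move=> mf; have mEf : measurable_fun setT (fun x : R => (f x)%:E) by exact/measurable_EFinP.
have ge0E (h : R -> \bar R) : measurable_fun (@setT R) h -> (forall x, (0 <= h x)%E) ->
    (\int[zero_inflated_poisson gamma]_x h x = \int[counting]_k
      ((zero_inflated_poisson_mass gamma%:num k)%:E * h k%:R))%E.
  move=> mh h0; rewrite ge0_integral_count => [|k]; last first.
    by rewrite mule_ge0// lee_fin zero_inflated_poisson_mass_ge0.
  rewrite /zero_inflated_poisson ge0_integral_measure_series//.
  apply: eq_eseriesr => k _; rewrite ge0_integral_mscale//.
  by rewrite integral_dirac// diracT mul1e.
rewrite /Rintegral integralE !ge0E//; last 2 first.
- exact: measurable_funeneg.
- exact: measurable_funepos.
rewrite [in RHS]integralE; congr (fine (_ - _)%E); apply: eq_integral => k _.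
- by rewrite !funeposE EFinM maxe_pMr ?mule0// lee_fin zero_inflated_poisson_mass_ge0.
- rewrite !funenegE EFinM -muleN maxe_pMr ?mule0//.
  by rewrite lee_fin zero_inflated_poisson_mass_ge0.
Qed.

(** * The spectrum of [Rtilde] through column counts *)

Section SpectrumRtilde.
Context (R : realType) (d : measure_display) (T : measurableType d).
Context (P : probability T R) (X : nat -> nat -> {RV P >-> R}).
Variables (p n : nat) (k : nat -> {RV P >-> nat}).

(* Rows of [X] which vanish identically give zero rows of [Z]. *)
Definition column_count (j : nat) (w : T) : R :=
  \sum_(i < p) ((k i w == j) && (X i j w != 0))%:R.

Lemma Yentry_neq0 i j w : (j < n)%N -> (Yentry X n i j w != 0) = (X i j w != 0).
Proof.
move=> jn; rewrite /Yentry mulf_eq0 negb_or invr_eq0.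
case: (eqVneq (X i j w) 0) => //= X0.
rewrite sqrtr_eq0 -ltNge (bigD1 (Ordinal jn))//= ltr_pwDl//.
  by rewrite exprn_even_gt0.
by apply: sumr_ge0 => l _; exact: sqr_ge0.
Qed.

Lemma gram_Zmatrix w :
  (Zmatrix X p n k w)^T *m Zmatrix X p n k w =
  diag_mx (\row_(j < n) column_count j w).
Proof.
apply/matrixP => a b; rewrite !mxE.
under eq_bigr do rewrite !mxE.
have [<-|ab] := eqVneq a b; last first.
  (* A row has at most one nonzero entry, so distinct columns have disjoint supports. *)
  rewrite mulr0n big1// => i _; case: (eqVneq (a : nat) (k i w)) => [<-|_].
    by rewrite (_ : (b == a :> nat) = false) ?mulr0//; apply/negbTE; rewrite eq_sym.
  by rewrite mulr0 mul0r.
rewrite mulr1n; apply: eq_bigr => i _; rewrite [k i w == a]eq_sym.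
case: (eqVneq (a : nat) (k i w)) => [<-|_]; last by rewrite !mulr0.
by rewrite !mulr1 /= -expr2 sqr_sg Yentry_neq0.
Qed.

Lemma Rintegral_esd_Rtilde (f : R -> R) w : continuous f -> (0 < p)%N ->
  \int[esd (Rtilde X p n k w)]_x f x =
  (1 - n%:R / p%:R) * f 0 + p%:R^-1 * \sum_(j < n) f (column_count j w).
Proof.
move=> cf p0; rewrite Rintegral_esd; last exact: continuous_measurable_fun.
have := sum_eigenvalues_gram f (gram_Zmatrix w).
under [X in _ = X + _ -> _]eq_bigr do rewrite mxE.
rewrite -/(Rtilde X p n k w) => /(canRL (addrK _)) ->.
have p0' : p%:R != 0 :> R by rewrite pnatr_eq0 -lt0n.
by field.
Qed.

Lemma measurable_column_count j : measurable_fun setT (column_count j).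
Proof.
apply: measurable_sum => i.
apply: (@measurableT_comp _ _ _ T bool R (fun b : bool => b%:R)) => //.
apply: measurable_and.
  by apply: measurable_fun_eqn => //; exact: measurable_cst.
apply: measurable_neg.
by apply: measurable_fun_eqr => //; exact: measurable_cst.
Qed.

(** If the entry at a maximizer were 0, the whole row would vanish, so outside [some_zero_row] no
    ball is lost. *)
Lemma column_count_mem j w : (j < n)%N -> ~ some_zero_row X p n w ->
  (forall i, (i < p)%N -> k i w \in argmax_row X n i w) ->
  column_count j w = (count_mem j [seq k i w | i <- iota 0 p])%:R.
Proof.
move=> jn nz kP; rewrite count_map -sum1_count natr_sum big_mkcond.
have -> : iota 0 p = index_iota 0 p by rewrite /index_iota subn0.
rewrite big_mkord; apply: eq_bigr => i _ /=.
case: (eqVneq (k i w) j) => //= kj.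
case: (eqVneq (X i j w) 0) => //= Xj; exfalso; apply: nz.
rewrite /some_zero_row -bigcup_mkord; exists i => //= l ln.
have := kP i (ltn_ord i); rewrite argmax_rowE kj => /maximizersP[_ /(_ l ln)].
by rewrite Xj normr0 normr_le0 => /eqP.
Qed.

End SpectrumRtilde.

(** * The spectral integral as a function of the allocation *)

Section LinearStatistic.
Context (R : realType) (p n : nat) (f : R -> R) (M : R).

Definition esd_statistic (s : seq nat) : R :=
  (1 - n%:R / p%:R) * f 0 +
  p%:R^-1 * \sum_(j < n) f (count_mem (nat_of_ord j) s)%:R.

Lemma avg_esd_statistic : (0 < n)%N ->
  avg n p esd_statistic = (1 - n%:R / p%:R) * f 0 + n%:R / p%:R *
    \sum_(k < p.+1) binomial_weight R n p k * f k%:R.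
Proof.
move=> n0; rewrite /esd_statistic avgD// avg_cst// avgZ// avg_sum//.
under eq_bigr do rewrite (avg_count_mem n0 p (fun k => f k%:R))//.
set S := \sum_(k < p.+1) _; rewrite sumr_const card_ord.
by rewrite -[S *+ n]mulr_natl mulrA [_^-1 * _]mulrC.
Qed.

(** Moving one ball from [a] to [b] only affects the counts of these two boxes, and each of the two
    terms changes by at most [2 * M]. *)
Lemma bounded_differences_esd_statistic : (forall x, `|f x| <= M) ->
  bounded_differences esd_statistic (p%:R^-1 * (4 * M)).
Proof.
move=> fM s1 s2 a b.
have M0 : 0 <= M := le_trans (normr_ge0 _) (fM 0).
rewrite /esd_statistic opprD addrACA subrr add0r -mulrBr normrM.
rewrite ger0_norm ?invr_ge0// ler_wpM2l ?invr_ge0// -sumrB.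
have M2 : 2 * M = M + M by ring.
(* Only an inequality: letters of arbitrary words may be [n] or more, and then the sum is 0. *)
have sum1 c : \sum_(j < n) ((c == j :> nat)%:R : R) <= 1.
  have [cn|nc] := ltnP c n.
    rewrite (bigD1 (Ordinal cn))//= eqxx big1 ?addr0// => j jc.
    rewrite (_ : (c == j :> nat) = false)//; apply/negbTE.
    by apply: contra jc => /eqP cj; apply/eqP/val_inj.
  rewrite big1// => j _; rewrite (_ : (c == j :> nat) = false)//.
  by apply/negbTE; rewrite gtn_eqF// (leq_trans (ltn_ord j)).
apply: le_trans (ler_norm_sum _ _ _) _.
apply: (@le_trans _ _ (\sum_(j < n) 2 * M * ((a == j :> nat)%:R + (b == j :> nat)%:R))).
  apply: ler_sum => j _; rewrite !count_cat /=.
  case: (eqVneq a j) => aj; case: (eqVneq b j) => bj /=;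
    rewrite ?subrr ?normr0 ?addr0 ?add0r ?mulr0 ?mulr1//.
  - by rewrite !mulr_ge0.
  - by apply: le_trans (ler_normB _ _) _; rewrite M2 lerD.
  - by apply: le_trans (ler_normB _ _) _; rewrite M2 lerD.
rewrite -mulr_sumr big_split/=.
have -> : 4 * M = 2 * M * (1 + 1) by ring.
by rewrite ler_wpM2l ?mulr_ge0// lerD.
Qed.

End LinearStatistic.

(** Induction on [l], splitting over the countably many values of the first index. *)
Lemma measurable_seq_event (d : measure_display) (T : measurableType d)
    (k : nat -> T -> nat) (l : seq nat) (E : pred (seq nat)) :
  (forall i, measurable_fun setT (k i)) ->
  measurable [set w | E [seq k i w | i <- l]].
Proof.
move=> mk; elim: l E => [|i l ih] E /=.
  case: (E [::]); first by rewrite (_ : [set _ | _] = setT)//; apply/seteqP; split.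
  by rewrite (_ : [set _ | _] = set0)//; apply/seteqP; split.
rewrite (_ : [set _ | _] = \bigcup_m ((k i @^-1` [set m]) `&`
    [set w | E (m :: [seq k i w | i <- l])])).
  apply: bigcupT_measurable => m; apply: measurableI.
    by rewrite -[X in measurable X]setTI; exact: mk.
  exact: (ih (fun s => E (m :: s))).
apply/seteqP; split=> w /=; first by move=> h; exists (k i w).
by move=> [m _ [/= -> ]].
Qed.

Lemma measurable_deviation (d : measure_display) (T : measurableType d)
    (R : realType) (g : T -> R) (l eps : R) : measurable_fun setT g ->
  measurable [set w | eps < `|g w - l|].
Proof.
move=> mg; have mlt : measurable_fun setT (fun w => eps < `|g w - l|).
  apply: measurable_fun_ltr => //; apply: measurableT_comp => //.
  by apply: measurable_funB => //; exact: measurable_cst.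
by rewrite -[X in measurable X]setTI; exact: (mlt measurableT [set true]).
Qed.

(** * Deviation bound at fixed [n] and [p] *)

Section MainEstimate.
Context (R : realType).
Context (d0 : measure_display) (T0 : measurableType d0) (Q : probability T0 R)
  (xi : {RV Q >-> R}).
Context (d : measure_display) (T : measurableType d) (P : probability T R)
  (X : nat -> nat -> {RV P >-> R}).
Hypothesis iidX : iid_copies xi X.
Variables (p n : nat) (k : nat -> {RV P >-> nat}) (f : R -> R) (M : R).
Hypotheses (n0 : (0 < n)%N) (p0 : (0 < p)%N).
Hypothesis kP : random_argmax X p n k.
Hypotheses (cf : continuous f) (fM : forall x, `|f x| <= M).

Lemma measurable_Rintegral_esd_Rtilde :
  measurable_fun setT (fun w => \int[esd (Rtilde X p n k w)]_x f x).
Proof.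
under eq_fun do rewrite Rintegral_esd_Rtilde//.
apply: measurable_funD; first exact: measurable_cst.
apply: measurable_funM; first exact: measurable_cst.
apply: measurable_sum => j; apply: measurableT_comp.
  exact: continuous_measurable_fun.
exact: measurable_column_count.
Qed.

(** Either some row vanishes, or the integral equals [esd_statistic] at the random indices and a
    deviation of [eps] from [l] forces one of [eps / 2] from the mean. *)
Lemma probability_esd_deviation_le (l eps : R) : 0 < eps ->
  `|l - avg n p (esd_statistic p n f)| < eps / 2 ->
  (P [set w | (eps < `|\int[esd (Rtilde X p n k w)]_x f x - l|)%R] <=
   (64 * M ^+ 2 / eps ^+ 2 * p%:R^-1 +
    p%:R * fine (Q (xi @^-1` [set 0%R])) ^+ n)%:E)%E.
Proof.
move=> e0; set F := esd_statistic p n f; set mu := avg n p F => lmu.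
pose bad (s : seq nat) := (eps < `|F s - l|)%R.
pose K w := [seq k i w | i <- iota 0 p].
have mZ := measurable_some_zero_row X p n.
have mbad : measurable [set w | bad (K w)].
  by apply: measurable_seq_event => i.
have sub : [set w | (eps < `|\int[esd (Rtilde X p n k w)]_x f x - l|)%R] `<=`
    [set w | bad (K w)] `|` some_zero_row X p n.
  move=> w /= h; have [nz|nz] := pselect (some_zero_row X p n w); first by right.
  left; rewrite /bad /F /esd_statistic; move: h.
  rewrite Rintegral_esd_Rtilde//.
  under eq_bigr => j _ do rewrite (column_count_mem (ltn_ord j) nz (fun i => kP.1 i w)).
  by [].
have mE : measurable [set w | (eps < `|\int[esd (Rtilde X p n k w)]_x f x - l|)%R].
  exact: measurable_deviation measurable_Rintegral_esd_Rtilde.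
apply: le_trans (le_measure P _ _ sub) _; rewrite ?inE//; first exact: measurableU.
apply: le_trans (measureU2 P mbad mZ) _.
rewrite EFinD leeD//; last exact: probability_some_zero_row_le.
apply: le_trans (_ : ((avg n p (fun s => (bad s)%:R))%:E <= _)%E).
  by rewrite -(probability_argmax_avg iidX n0 kP).
rewrite lee_fin.
have e2 : 0 < eps / 2 by rewrite divr_gt0.
have pR : p%:R != 0 :> R by rewrite pnatr_eq0 -lt0n.
have eR : eps != 0 := lt0r_neq0 e0.
have := avg_chebyshev n0 p e2 (bounded_differences_esd_statistic p n fM).
(* The constant 64 is 16 from [(4 * M) ^+ 2] times 4 from [(eps / 2) ^+ 2]. *)
have -> : p%:R * (p%:R^-1 * (4 * M)) ^+ 2 / (eps / 2) ^+ 2 =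
    64 * M ^+ 2 / eps ^+ 2 * p%:R^-1.
  by field; rewrite pR eR.
apply: le_trans; apply: ler_avg => s; rewrite ler_nat /bad -/F -/mu.
case: (ltP eps) => //= h.
suff -> : eps / 2 < `|F s - mu| by [].
have := ler_distD mu (F s) l; rewrite [`|mu - l|]distrC; lra.
Qed.

End MainEstimate.

Theorem proposition4p8 (R : realType)
    (d0 : measure_display) (T0 : measurableType d0) (Q : probability T0 R)
    (xi : {RV Q >-> R})
    (d : measure_display) (T : measurableType d) (P : probability T R)
    (X : nat -> nat -> {RV P >-> R})
    (p : nat -> nat) (gamma : {posnum R})
    (k : nat -> nat -> {RV P >-> nat}) :
  symmetric_law xi ->
  slowly_varying xi ->
  iid_copies xi X ->
  p n @[n --> \oo] --> \oo ->
  (p n)%:R / n%:R @[n --> \oo] --> gamma%:num ->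
  (forall n, (0 < n)%N -> random_argmax X (p n) n (k n)) ->
  weakly_cvg_in_probability P
    (fun n w => esd (Rtilde X (p n) n (k n) w)) (zero_inflated_poisson gamma).
Proof.
move=> _ sv iidX poo pg kP f cf [M fM] eps e0.
set l := \int[_]_x f x.
have g0 : 0 < gamma%:num by [].
have q0 : 0 <= fine (Q (xi @^-1` [set 0])) by rewrite fine_ge0.
have q1 := slowly_varying_atom0_lt1 sv; set q := fine _ in q0 q1.
(* The bias tends to 0, so it is eventually below the [eps / 2] allowed by the deviation bound. *)
have avgl : avg n (p n) (esd_statistic (p n) n f) @[n --> \oo] --> l.
  rewrite /l Rintegral_zero_inflated_poisson; last exact: continuous_measurable_fun.
  have := cvg_zero_inflated_mean g0 poo pg (fun k => fM k%:R).
  apply: cvg_trans; apply: near_eq_cvg; near=> n.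
  by rewrite avg_esd_statistic//; near: n; exact: nbhs_infty_gt.
apply: (@squeeze_cvge _ _ _ _ (fun=> 0%E) _
  (fun n => (64 * M ^+ 2 / eps ^+ 2 * (p n)%:R^-1 + (p n)%:R * q ^+ n)%:E)).
- near=> n; rewrite measure_ge0 /=.
  have n0 : (0 < n)%N by near: n; exact: nbhs_infty_gt.
  apply: (probability_esd_deviation_le iidX n0 _ (kP n n0) cf fM e0).
    by near: n; move/cvgnyPge : poo; apply.
  near: n; move/cvgrPdist_lt : avgl; apply; exact: divr_gt0.
- exact: cvg_cst.
- apply: cvg_EFin; first exact: nearW.
  rewrite -[X in _ --> X]addr0; apply: cvgD.
    rewrite -[X in _ --> X](mulr0 (64 * M ^+ 2 / eps ^+ 2)); apply: cvgMr.
    exact: (cvg_comp _ _ poo (@cvg_natV R)).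
  (* The term [p q^n] is split as [(p / n) (n q^n)]: the first factor converges and the second tends
     to 0. *)
  have : (p n)%:R / n%:R * (n%:R * q ^+ n) @[n --> \oo] --> gamma%:num * 0.
    by apply: cvgM => //; exact: cvg_natmul_expr.
  rewrite mulr0; apply: cvg_trans; apply: near_eq_cvg; near=> n.
  have n0 : n%:R != 0 :> R by rewrite pnatr_eq0 -lt0n; near: n; exact: nbhs_infty_gt.
  by rewrite /= mulrA divfK.
Unshelve. all: by end_near. Qed.
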